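(* Let $f:\mathbb R^2\to\mathbb R$, $f(y_1,y_2):=\max(e^{-y_1}+y_2,\ y_2^2)$, and let $g:\mathbb R\to(-\infty,+\infty]$ be the indicator function of the nonnegative reals, i.e. $g(z)=0$ if $z\ge0$ and $g(z)=+\infty$ otherwise. Let $\mathcal A^*:\mathbb R^2\to\mathbb R$, $\mathcal A^*(y_1,y_2)=y_2$, $\mathcal B^*:\mathbb R\to\mathbb R$, $\mathcal B^*z=-z$, and $c=2$. Consider the problem $$\min_{(y_1,y_2,z)\in\mathbb R^3}\{f(y_1,y_2)+g(z)\ :\ y_2-z=2\}.$$ Then: (P1) $f$ and $g$ are closed proper convex functions; (P2) the Lagrangian $\mathcal L(y,z;x)=f(y)+g(z)+x(y_2-z-2)$ has infinitely many saddle points; (P3) Slater's constraint qualification holds, i.e. there exist $y\in\operatorname{ri}(\operatorname{dom} f)$ and $z\in\operatorname{ri}(\operatorname{dom} g)$ with $\mathcal A^*y+\mathcal B^*z=c$; (P4) $\mathcal B$ is nonsingular. Nevertheless, for the penalty parameter $\sigma=1$ and the initial point $(x^0,y_1^0,y_2^0,z^0)=(0,0,0,0)$, the first subproblem of the ADMM, $$\min_{(y_1,y_2)\in\mathbb R^2}\mathcal L_\sigma(y_1,y_2,z^0;x^0),$$ has finite infimum $\tfrac32$, which is not attained at any $(y_1,y_2)\in\mathbb R^2$. Hence this subproblem has no solution and the ADMM scheme is not well-defined.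
   Context: The augmented Lagrangian is $\mathcal L_\sigma(y_1,y_2,z;x):=f(y_1,y_2)+g(z)+x(y_2-z-2)+\tfrac\sigma2(y_2-z-2)^2$. A saddle point of $\mathcal L$ is a point $(\bar x,\bar y,\bar z)\in\mathbb R\times\mathbb R^2\times\mathbb R$ with $(\bar y,\bar z)\in\operatorname{dom} f\times\operatorname{dom} g$ such that $\mathcal L(\bar y,\bar z;x)\le\mathcal L(\bar y,\bar z;\bar x)\le\mathcal L(y,z;\bar x)$ for all $x,y,z$. $\operatorname{ri}$ denotes the relative interior and $\operatorname{dom}$ the effective domain. The ADMM (alternating direction method of multipliers) scheme with step-length $\tau>0$ iterates: $y^{k+1}\in\arg\min_y\mathcal L_\sigma(y,z^k;x^k)$, $z^{k+1}\in\arg\min_z\mathcal L_\sigma(y^{k+1},z;x^k)$, $x^{k+1}=x^k+\tau\sigma(\mathcal A^*y^{k+1}+\mathcal B^*z^{k+1}-c)$. It is well-defined only if every subproblem has a minimizer. *)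

(* Defs.v *)
From HB Require Import structures.
From mathcomp Require Import all_boot all_order all_algebra.
From mathcomp Require Import all_classical all_reals all_analysis.

Set Implicit Arguments.
Unset Strict Implicit.
Unset Printing Implicit Defensive.
Import Order.TTheory GRing.Theory Num.Theory.
Import numFieldNormedType.Exports.

Local Open Scope classical_set_scope.
Local Open Scope ring_scope.
Local Open Scope ereal_scope.

Section ConvexAnalysis.
Context {R : realType} {V : normedModType R}.
Implicit Types (h : V -> \bar R) (A M : set V).

Definition edom h : set V := [set v | h v < +oo].

Definition epigraph h : set (V * R^o) := [set p | h p.1 <= (p.2)%:E].

Definition proper h : Prop := edom h !=set0 /\ forall v, -oo < h v.

(* For a proper convex function, closed means lower semicontinuous. *)
Definition closed_proper_convex h : Prop :=
  [/\ lower_semicontinuous h, proper h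
    & convex_set (epigraph h : set (convex_lmodType (V * R^o)%type))].

Definition affine_set M : Prop :=
  forall u v (t : R), M u -> M v -> M ((1 - t) *: u + t *: v)%R.

Definition affine_hull A : set V :=
  \bigcap_(M in [set M | affine_set M /\ A `<=` M]) M.

(* The interior of A relative to its affine hull.  On R * R the norm of the
   library is the maximum norm, which gives the Euclidean topology. *)
Definition ri A : set V :=
  [set v | affine_hull A v /\
     exists2 e : R, (0 < e)%R & ball v e `&` affine_hull A `<=` A].

End ConvexAnalysis.

Definition argmin {R : realType} {T : Type} (h : T -> \bar R) : set T :=
  [set t | forall t', h t <= h t'].

(* B^* is the adjoint of B, for the inner product (a, b) |-> a * b of R. *)
Definition adjoint {R : realType} (B Bs : R -> R) : Prop :=
  forall x z : R, (B x * z = x * Bs z)%R.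

(* The problem  min { f y + g z | As y + Bs z = c }  with a scalar constraint;
   As and Bs stand for A^* and B^*. *)
Section ADMM.
Context {R : realType} {Y Z : normedModType R}.
Variables (f : Y -> \bar R) (g : Z -> \bar R) (As : Y -> R) (Bs : Z -> R).
Variable c : R.

Definition lagrangian (y : Y) (z : Z) (x : R) : \bar R :=
  f y + g z + (x * (As y + Bs z - c))%:E.

Definition aug_lagrangian (sigma : R) (y : Y) (z : Z) (x : R) : \bar R :=
  f y + g z + (x * (As y + Bs z - c))%:E
  + (sigma / 2 * (As y + Bs z - c) ^+ 2)%:E.

(* Points are listed in the order (x, y, z). *)
Definition saddle_point (p : R * Y * Z) : Prop :=
  let: (xb, yb, zb) := p in
  [/\ edom f yb, edom g zb
    & forall x y z, lagrangian yb zb x <= lagrangian yb zb xb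
                    /\ lagrangian yb zb xb <= lagrangian y z xb].

Definition slater : Prop :=
  exists y z, [/\ ri (edom f) y, ri (edom g) z & (As y + Bs z = c)%R].

Definition y_subproblem (sigma : R) (s : R * Y * Z) : Y -> \bar R :=
  let: (x, _, z) := s in fun y => aug_lagrangian sigma y z x.

Definition z_subproblem (sigma : R) (s : R * Y * Z) (y' : Y) : Z -> \bar R :=
  let: (x, _, _) := s in fun z => aug_lagrangian sigma y' z x.

Definition multiplier_update (sigma tau : R) (s : R * Y * Z) (y' : Y) (z' : Z)
    : R :=
  let: (x, _, _) := s in (x + tau * sigma * (As y' + Bs z' - c))%R.

(* A state is reachable when it is an iterate (x^k, y^k, z^k) for some
   choice of the minimizers so far. *)
Inductive admm_reachable (sigma tau : R) (s0 : R * Y * Z) :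
    R * Y * Z -> Prop :=
| admm_init : admm_reachable sigma tau s0 s0
| admm_step s y' z' :
    admm_reachable sigma tau s0 s ->
    argmin (y_subproblem sigma s) y' ->
    argmin (z_subproblem sigma s y') z' ->
    admm_reachable sigma tau s0 (multiplier_update sigma tau s y' z', y', z').

Definition admm_well_defined (sigma tau : R) (s0 : R * Y * Z) : Prop :=
  forall s, admm_reachable sigma tau s0 s ->
    argmin (y_subproblem sigma s) !=set0 /\
    forall y', argmin (y_subproblem sigma s) y' ->
      argmin (z_subproblem sigma s y') !=set0.

End ADMM.

Section Example.
Context {R : realType}.

Definition f_ex (y : R^o * R^o) : R :=
  Num.max (expR (- y.1) + y.2)%R (y.2 ^+ 2)%R.

Definition g_ex (z : R^o) : \bar R := if (0 <= z)%R then 0 else +oo.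

Definition Astar (y : R^o * R^o) : R := y.2.

Definition Bstar (z : R^o) : R := (- z)%R.

End Example.

(* Main.v *)
(* The first objective is f(y) + (y2 - 2)^2 / 2, and f(y) > y2 because
   exp(- y1) > 0; hence it exceeds
     y2 + (y2 - 2)^2 / 2 = 3 / 2 + (y2 - 1)^2 / 2 >= 3 / 2.
   The value 3 / 2 is approached along y2 = 1, y1 -> +oo, and only there. *)
Require Import Defs.
From HB Require Import structures.
From mathcomp Require Import all_boot all_order all_algebra.
From mathcomp Require Import all_classical all_reals all_analysis.
From mathcomp Require Import ring lra.
Import Order.TTheory GRing.Theory Num.Theory.
Import numFieldNormedType.Exports.
Local Open Scope classical_set_scope.
Local Open Scope ring_scope.

Section ConvexAnalysisLemmas.
Context {R : realType} {V : normedModType R}.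

Lemma sub_affine_hull (A : set V) : A `<=` affine_hull A.
Proof. by move=> v Av M [_]; apply. Qed.

(** A ball contained in [A] stays in [A] after intersection with the affine hull. Slater's condition
    can thus be checked with ordinary interiors. *)
Lemma interior_sub_ri (A : set V) : A° `<=` ri A.
Proof.
move=> v Av; split; first by apply: sub_affine_hull; exact: interior_subset.
move: Av; rewrite /interior /= -nbhs_ballE => -[e /= e0 eA].
by exists e => // u [/eA].
Qed.

(** For a finite-valued function, continuity gives lower semicontinuity, and the Jensen inequality
    puts convex combinations of epigraph points back in the epigraph. *)
Lemma closed_proper_convex_EFin (h : V -> R) :
  continuous (h : V -> R^o) ->
  (forall (t : {i01 R}) u v,
    h (t%:num *: u + (1 - t%:num) *: v) <= t%:num * h u + (1 - t%:num) * h v) ->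
  closed_proper_convex (fun v => (h v)%:E).
Proof.
move=> ch convh; split.
- move=> v a; rewrite lte_fin => av; exists [set u | a < h u].
    exact: (ch v _ (lt_nbhsr av)).
  by move=> u /=; rewrite lte_fin.
- by split=> [|v]; [exists 0; rewrite /edom /= ltry | rewrite ltNyr].
- move=> [u a] [v b] t; rewrite !inE /epigraph /= !lee_fin => hu hv.
  apply: (le_trans (convh t u v)).
  by rewrite lerD// ler_wpM2l// onem_ge0.
Qed.

End ConvexAnalysisLemmas.

Section Example.
Context {R : realType}.
Implicit Types (y : R^o * R^o) (t : R).

Lemma f_ex_gt y : y.2 < f_ex y.
Proof. by rewrite /f_ex lt_max ltrDr expR_gt0. Qed.

Lemma f_ex_ge_sqr y : y.2 ^+ 2 <= f_ex y.
Proof. by rewrite /f_ex le_max lexx orbT. Qed.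

Lemma continuous_f_ex : continuous (@f_ex R : R^o * R^o -> R^o).
Proof.
move=> y; apply: (@continuous_max _ _ (fun y : R^o * R^o => expR (- y.1) + y.2)
  (fun y => y.2 ^+ 2)).
- apply: cvgD; last exact: cvg_snd.
  apply: (@continuous_comp _ _ _ (fun y : R^o * R^o => - y.1) expR).
    by apply: cvgN; exact: cvg_fst.
  exact: continuous_expR.
- apply: (@continuous_comp _ _ _ snd (fun z : R => z ^+ 2)); first exact: cvg_snd.
  exact: exprn_continuous.
Qed.

(** A maximum of two convex functions is convex, so each branch is bounded on its own by the
    combination of the maxima. *)
Lemma closed_proper_convex_f_ex :
  closed_proper_convex (fun y : R^o * R^o => (f_ex y)%:E).
Proof.
apply: closed_proper_convex_EFin; first exact: continuous_f_ex.
move=> t [u1 u2] [v1 v2] /=; rewrite /f_ex /= ge_max.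
have t0 : 0 <= t%:num by [].
have t1 : 0 <= (1 - t%:num) by rewrite subr_ge0.
apply/andP; split.
- apply: (@le_trans _ _ (t%:num * (expR (- u1) + u2) + (1 - t%:num) * (expR (- v1) + v2))).
    (* The exponent is linear in the first coordinate, so convexity of [expR] at the negated points
       suffices; the summand [y.2] contributes equally to both sides. *)
    have := convex_expR t (- u1) (- v1); rewrite !convRE => H.
    rewrite opprD -!mulrN /GRing.scale /= /unstable.onem in H *; lra.
  by rewrite lerD// ler_wpM2l// le_max lexx.
- apply: (@le_trans _ _ (t%:num * u2 ^+ 2 + (1 - t%:num) * v2 ^+ 2)).
    rewrite /GRing.scale /= -subr_ge0.
    have -> : t%:num * u2 ^+ 2 + (1 - t%:num) * v2 ^+ 2 -
        (t%:num * u2 + (1 - t%:num) * v2) ^+ 2 =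
        t%:num * (1 - t%:num) * (u2 - v2) ^+ 2 by ring.
    by rewrite mulr_ge0 ?sqr_ge0// mulr_ge0.
  by rewrite lerD// ler_wpM2l// le_max lexx orbT.
Qed.

Lemma edom_g_ex : edom (@g_ex R) = [set z | 0 <= z].
Proof.
by apply/seteqP; split=> z; rewrite /edom /g_ex /=; case: ifP => //; rewrite ltry.
Qed.

Lemma closed_proper_convex_g_ex : closed_proper_convex (@g_ex R).
Proof.
split.
- move=> z a; rewrite /g_ex; case: (leP 0 z) => z0 az.
    (* Here [a] is negative, hence below both values of [g_ex], and the whole line serves as
       neighbourhood. *)
    exists setT; first exact: filterT.
    by move=> w _; case: ifP => // _; rewrite ltry.
  exists [set w | w < 0]; first exact: lt_nbhsl.
  by move=> w /= w0; rewrite leNgt w0 /= ltry.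
- split; first by rewrite edom_g_ex; exists 0 => /=.
  by move=> z; rewrite /g_ex; case: ifP.
- move=> [z a] [w b] t; rewrite !inE /epigraph /g_ex /=.
  case: (leP 0 z) => // z0; case: (leP 0 w) => // w0; rewrite !lee_fin => a0 b0.
  have t1 : 0 <= (1 - t%:num) by rewrite subr_ge0.
  by rewrite addr_ge0 ?mulr_ge0// lee_fin addr_ge0 ?mulr_ge0.
Qed.

(* The multiplier -4 is minus the derivative of y2 |-> y2 ^ 2 at y2 = 2; every
   y1 >= 0 (in fact y1 >= - ln 2) makes y2 ^ 2 the active branch there. *)
Lemma saddle_point_ex t : 0 <= t ->
  saddle_point (fun y => (f_ex y)%:E) g_ex Astar Bstar 2 (-4, (t, 2), 0).
Proof.
move=> t0.
have ft : f_ex (t, 2) = 4 :> R.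
  have e1 : expR (- t) <= 1 by rewrite expR_le1 oppr_le0.
  by rewrite /f_ex /=; apply/eqP; rewrite eq_le ge_max le_max; lra.
split; [by rewrite /edom /= ltry|by rewrite edom_g_ex /=|].
move=> x y z; rewrite /lagrangian /g_ex /Astar /Bstar /= lexx ft; split.
  (* The point is feasible, so the multiplier term vanishes for every [x]. *)
  by rewrite -!EFinD lee_fin; lra.
case: (leP 0 z) => z0; last by rewrite addey// addye// leey.
rewrite -!EFinD lee_fin.
(* With the multiplier -4, the quadratic branch alone gives a Lagrangian of at least
   [4 + (y.2 - 2) ^+ 2 + 4 * z]. *)
have := f_ex_ge_sqr y; have := sqr_ge0 (y.2 - 2); lra.
Qed.

Lemma infinite_saddle_points :
  infinite_set (saddle_point (fun y => (f_ex y)%:E) (@g_ex R) Astar Bstar 2).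
Proof.
(* An injective sequence of saddle points: were their set finite, its preimage, all of [nat], would
   be finite. *)
move=> /(finite_preimage (f := fun n : nat => (-4, (n%:R, 2), 0))) fin.
apply: infinite_nat; apply: sub_finite_set (fin _) => [n _|m n _ _ [/eqP]].
  by apply: saddle_point_ex; rewrite ler0n.
by rewrite eqr_nat => /eqP.
Qed.

Lemma slater_ex : slater (fun y => (f_ex y)%:E) (@g_ex R) Astar Bstar 2.
Proof.
(* Any [z > 0] is interior to the half-line; [z = 1] forces the second coordinate to be 3, and the
   first is free. *)
exists (0, 3), 1; split; last by rewrite /Astar /Bstar /=; lra.
- apply: interior_sub_ri; rewrite (_ : edom _ = setT) ?interiorT//.
  by apply/seteqP; split=> // y _; rewrite /edom /= ltry.
- apply: interior_sub_ri; rewrite edom_g_ex.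
  have : \forall z \near (1 : R^o), 0 < z by apply: lt_nbhsr; exact: ltr01.
  by apply: filterS => z /ltW.
Qed.

(** Negation on the line is self-adjoint and an involution. *)
Lemma bijective_adjoint_Bstar :
  exists B : {linear R^o -> R^o}, adjoint B Bstar /\ bijective B.
Proof.
exists (@GRing.opp R^o); split; last exact: inv_bij opprK.
by move=> x z; rewrite /Bstar /= mulNr mulrN.
Qed.

Let first_subproblem : R^o * R^o -> \bar R :=
  y_subproblem (fun y => (f_ex y)%:E) g_ex Astar Bstar 2 1 (0, (0, 0), 0).

Lemma first_subproblemE y :
  first_subproblem y = (f_ex y + (y.2 - 2) ^+ 2 / 2)%:E.
Proof.
rewrite /first_subproblem /= /aug_lagrangian /g_ex lexx /Astar /Bstar -!EFinD.
by congr EFin; lra.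
Qed.

Lemma first_subproblem_gt y : ((3 / 2)%:E < first_subproblem y)%E.
Proof.
rewrite first_subproblemE lte_fin.
have := f_ex_gt y; have := sqr_ge0 (y.2 - 1); lra.
Qed.

Lemma ereal_inf_first_subproblem :
  ereal_inf (range first_subproblem) = (3 / 2)%:E.
Proof.
apply/eqP; rewrite eq_le; apply/andP; split; last first.
  by apply: le_ereal_inf_tmp => _ [y _ <-]; exact/ltW/first_subproblem_gt.
apply/lee_addgt0Pr => e e0; apply: ge_ereal_inf.
(* At this point the exponential equals [e], so the maximum is [e + 1] and the objective is exactly
   [3 / 2 + e]. *)
exists (first_subproblem (- ln e, 1)); first by exists (- ln e, 1).
rewrite first_subproblemE lee_fin /f_ex /= opprK lnK ?posrE//.
by rewrite max_l; lra.
Qed.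

(** The value at a minimizer is a lower bound of the range, hence at most the infimum [3 / 2],
    against the strict bound. *)
Lemma argmin_first_subproblem : argmin first_subproblem = set0.
Proof.
apply/seteqP; split=> // y ymin; have := first_subproblem_gt y.
rewrite ltNge -ereal_inf_first_subproblem => /negP; apply.
by apply: le_ereal_inf_tmp => _ [y' _ <-]; exact: ymin.
Qed.

End Example.

Theorem mainTheorem2 (R : realType) :
  let f : R^o * R^o -> \bar R := fun y => (f_ex y)%:E in
  let g : R^o -> \bar R := g_ex in
  let s0 : R * (R^o * R^o) * R^o := (0, (0, 0), 0) in
  let first_subproblem : R^o * R^o -> \bar R :=
    y_subproblem f g Astar Bstar 2 1 s0 in
  (closed_proper_convex f /\ closed_proper_convex g) /\
  infinite_set (saddle_point f g Astar Bstar 2) /\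
  slater f g Astar Bstar 2 /\
  (exists B : {linear R^o -> R^o}, adjoint B Bstar /\ bijective B) /\
  ereal_inf (range first_subproblem) = (3 / 2)%:E /\
  (forall y, first_subproblem y <> (3 / 2)%:E) /\
  argmin first_subproblem = set0 /\
  (forall tau : R, 0 < tau ->
     ~ admm_well_defined f g Astar Bstar 2 1 tau s0).
Proof.
move=> f g s0 first_subproblem.
split; first by split; [exact: closed_proper_convex_f_ex|exact: closed_proper_convex_g_ex].
split; first exact: infinite_saddle_points.
split; first exact: slater_ex.
split; first exact: bijective_adjoint_Bstar.
split; first exact: ereal_inf_first_subproblem.
split; first by move=> y; apply/eqP/negbT/gt_eqF/first_subproblem_gt.
split; first exact: argmin_first_subproblem.
(* The scheme already breaks down at the initial state, before any multiplier update. *)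
move=> tau _ /(_ s0 (admm_init _ _ _ _ _ _ _ _)) [[y ymin] _].
by have : set0 y by rewrite -argmin_first_subproblem.
Qed.
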